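(* Let $F=(F_1,\dots,F_m):\mathbb{R}^n\to\mathbb{R}^m$ be twice continuously differentiable and let $\{x_k\}$ be an infinite sequence of points, none of which is Pareto critical, produced by the generic variable metric method (GVMM) from a starting point $x_0\in\mathbb{R}^n$, with associated matrices $\{B_k\}$ and directions $\{d_k\}$. Suppose that (1) there exist constants $a,b>0$ such that $aI\leqslant B_k\leqslant bI$ for all $k$; (2) for any $x_0\in\mathbb{R}^n$, the level set $\{x\in\mathbb{R}^n: F(x)\leqslant F(x_0)\}$ is compact. Then: (i) $\lim_{k\to\infty}(x_{k+1}-x_k)=0$. (ii) $\{x_k\}$ has at least one accumulation point, and every accumulation point of $\{x_k\}$ is a Pareto critical point. (iii) $\lim_{k\to\infty}d_k=0$.
   Context: For vectors, $F(y)\leqslant F(z)$ is meant componentwise. For symmetric matrices, $A\leqslant B$ means $B-A$ is positive semidefinite. $JF(x)\in\mathbb{R}^{m\times n}$ is the Jacobian of $F$ at $x$, and $\nabla F_i(x)$ is the gradient of $F_i$. $\Delta_m=\{\lambda\in\mathbb{R}^m:\sum_{i=1}^m\lambda_i=1,\ \lambda_i\geqslant 0\ \text{for all } i\}$. A point $x^*\in\mathbb{R}^n$ is Pareto critical for $F$ if $\mathrm{range}(JF(x^* ))\cap(-\mathbb{R}^m_{++})=\emptyset$, i.e. there is no $d\in\mathbb{R}^n$ with $\nabla F_i(x^* )^{\mathrm T}d<0$ for all $i=1,\dots,m$. GVMM: fixed parameters $\sigma,\gamma\in(0,1)$. Given the current iterate $x_k$ and a symmetric positive definite matrix $B_k\in\mathbb{R}^{n\times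 n}$ (the rule by which the matrices $B_k$ are updated is arbitrary), choose $$\lambda^k\in\arg\min_{\lambda\in\Delta_m}\tfrac12\Big(\sum_{i=1}^m\lambda_i\nabla F_i(x_k)\Big)^{\mathrm T}B_k^{-1}\Big(\sum_{i=1}^m\lambda_i\nabla F_i(x_k)\Big),\qquad d_k=-B_k^{-1}\sum_{i=1}^m\lambda_i^k\nabla F_i(x_k).$$ Let $\alpha_k$ be the first element of $1,\gamma,\gamma^2,\dots$ such that $F(x_k+\alpha_kd_k)-F(x_k)\leqslant\sigma\alpha_kJF(x_k)d_k$ componentwise (Armijo line search), and set $x_{k+1}=x_k+\alpha_kd_k$. (The algorithm stops only if $\tfrac12 d_k^{\mathrm T}B_kd_k$ is at most a given tolerance; it is assumed that it does not stop.) *)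

(* Defs.v *)
From HB Require Import structures.
From mathcomp Require Import all_boot all_order all_algebra.
From mathcomp Require Import all_classical all_reals all_analysis.

Set Implicit Arguments.
Unset Strict Implicit.
Unset Printing Implicit Defensive.

Import Order.TTheory GRing.Theory Num.Theory.
Import numFieldNormedType.Exports.

Local Open Scope classical_set_scope.
Local Open Scope ring_scope.

(* Vectors of R^n are row vectors.  The library Jacobian ['J F x] is the
   n x m matrix with ['d F x d = d *m 'J F x]; it is the transpose of the
   usual Jacobian JF(x), so JF(x) d is written [d *m 'J F x]. *)

Section Definitions.
Context {R : realType}.

(* The second derivative is ['d (fun y => 'J F y) x]; in finite dimension its
   continuity in operator norm is the continuity of its value at every [v]. *)
Definition twice_continuously_differentiable (n m : nat)
    (F : 'rV[R]_n -> 'rV[R]_m) : Prop :=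
  [/\ forall x, differentiable F x,
      forall x, differentiable (fun y => 'J F y) x &
      forall v, continuous (fun x => 'd (fun y => 'J F y) x v)].

Definition gradient (n m : nat) (F : 'rV[R]_n -> 'rV[R]_m) (i : 'I_m)
    (x : 'rV[R]_n) : 'rV[R]_n := (col i ('J F x))^T.

Definition level_set (n m : nat) (F : 'rV[R]_n -> 'rV[R]_m)
    (x0 : 'rV[R]_n) : set 'rV[R]_n :=
  [set x | forall i, F x 0 i <= F x0 0 i].

Definition pareto_critical (n m : nat) (F : 'rV[R]_n -> 'rV[R]_m)
    (x : 'rV[R]_n) : Prop :=
  range (fun d : 'rV[R]_n => d *m 'J F x) `&`
    [set y : 'rV[R]_m | forall i, y 0 i < 0] = set0.

Definition quad_form (n : nat) (A : 'M[R]_n) (v : 'rV[R]_n) : R :=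
  (v *m A *m v^T) 0 0.

Definition symmetric_posdef (n : nat) (A : 'M[R]_n) : Prop :=
  A^T = A /\ forall v, v != 0 -> 0 < quad_form A v.

(* Only used for symmetric [A] and [B]. *)
Definition loewner_le (n : nat) (A B : 'M[R]_n) : Prop :=
  forall v, 0 <= quad_form (B - A) v.

Definition simplex (m : nat) : set 'rV[R]_m :=
  [set lam | \sum_(i < m) lam 0 i = 1 /\ forall i, 0 <= lam 0 i].

Definition weighted_gradient (n m : nat) (F : 'rV[R]_n -> 'rV[R]_m)
    (x : 'rV[R]_n) (lam : 'rV[R]_m) : 'rV[R]_n :=
  \sum_(i < m) lam 0 i *: gradient F i x.

Definition dual_objective (n m : nat) (F : 'rV[R]_n -> 'rV[R]_m)
    (x : 'rV[R]_n) (B : 'M[R]_n) (lam : 'rV[R]_m) : R :=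
  2^-1 * quad_form (invmx B) (weighted_gradient F x lam).

(* For rows, B^-1 g becomes [g *m invmx B], as B is symmetric. *)
Definition gvmm_direction (n m : nat) (F : 'rV[R]_n -> 'rV[R]_m)
    (x : 'rV[R]_n) (B : 'M[R]_n) (d : 'rV[R]_n) : Prop :=
  exists lam : 'rV[R]_m,
    [/\ simplex lam,
        forall mu, simplex mu ->
          dual_objective F x B lam <= dual_objective F x B mu &
        d = - (weighted_gradient F x lam *m invmx B)].

Definition armijo (n m : nat) (sigma : R) (F : 'rV[R]_n -> 'rV[R]_m)
    (x d : 'rV[R]_n) (alpha : R) : Prop :=
  forall i, (F (x + alpha *: d) - F x) 0 i
            <= sigma * alpha * (d *m 'J F x) 0 i.

Definition armijo_step (n m : nat) (sigma gamma : R)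
    (F : 'rV[R]_n -> 'rV[R]_m) (x d : 'rV[R]_n) (alpha : R) : Prop :=
  exists j : nat,
    [/\ alpha = gamma ^+ j,
        armijo sigma F x d (gamma ^+ j) &
        forall l : nat, (l < j)%N -> ~ armijo sigma F x d (gamma ^+ l)].

Definition gvmm (n m : nat) (sigma gamma : R) (F : 'rV[R]_n -> 'rV[R]_m)
    (x : nat -> 'rV[R]_n) (B : nat -> 'M[R]_n) (d : nat -> 'rV[R]_n) : Prop :=
  forall k,
    [/\ symmetric_posdef (B k),
        gvmm_direction F (x k) (B k) (d k) &
        exists2 alpha : R, armijo_step sigma gamma F (x k) (d k) alpha &
          x k.+1 = x k + alpha *: d k].

End Definitions.

(* Main.v *)
Require Import Defs.
From HB Require Import structures.
From mathcomp Require Import all_boot all_order all_algebra.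
From mathcomp Require Import all_classical all_reals all_analysis.
From mathcomp Require Import ring lra.

Import Order.TTheory GRing.Theory Num.Theory.
Import numFieldNormedType.Exports.

Local Open Scope classical_set_scope.
Local Open Scope ring_scope.

(* Optimality of the dual weights makes d_k a descent direction for every F_i:
   grad F_i(x_k) . d_k <= - d_k^T B_k d_k <= - a |d_k|^2.  The Armijo rule then
   keeps the iterates in a compact level set and makes alpha_k |d_k|^2 tend to 0,
   so alpha_k d_k -> 0 because alpha_k <= 1.  If alpha_k < 1, the trial step
   alpha_k / gamma was rejected; by the mean value theorem the Jacobian varies by
   at least a constant times |d_k| along the vanishing segment from x_k to
   x_k + (alpha_k / gamma) d_k, so uniform continuity of the Jacobian on the
   level set forces d_k -> 0 without passing to subsequences.  Near a
   noncritical p some v satisfies grad F_i . v <= - c for all i, hence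
   d_k^T B_k v >= c whenever x_k is near p, which d_k -> 0 excludes. *)

(** * Quadratic forms and the max norm *)

Lemma quad_formD {R : realType} {n : nat} {A : 'M[R]_n} (u v : 'rV[R]_n) (t : R) :
  A^T = A ->
  quad_form A (u + t *: v)
  = quad_form A u + 2 * t * (u *m A *m v^T) 0 0 + t ^+ 2 * quad_form A v.
Proof.
move=> symA; have vAu : (v *m A *m u^T) 0 0 = (u *m A *m v^T) 0 0.
  have -> : v *m A *m u^T = (u *m A *m v^T)^T.
    by rewrite !trmx_mul trmxK symA mulmxA.
  by rewrite mxE.
rewrite /quad_form linearD/= linearZ/= mulmxDl mulmxDl mulmxDr mulmxDr.
rewrite -!scalemxAl -!scalemxAr.
move: vAu (u *m A *m u^T) (v *m A *m v^T).
move: (u *m A *m v^T) (v *m A *m u^T) => uv vu vAu uu vv.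
by rewrite !mxE vAu; ring.
Qed.

Lemma quad_form1 {R : realType} {n : nat} (v : 'rV[R]_n) :
  quad_form 1%:M v = \sum_j v 0 j ^+ 2.
Proof. by rewrite /quad_form mulmx1 mxE; apply: eq_bigr => j _; rewrite mxE. Qed.

Lemma quad_formB {R : realType} {n : nat} (A B : 'M[R]_n) v :
  quad_form (A - B) v = quad_form A v - quad_form B v.
Proof.
rewrite /quad_form mulmxBr mulmxBl.
by move: (v *m A *m v^T) (v *m B *m v^T) => a b; rewrite !mxE.
Qed.

Lemma quad_form_scalar {R : realType} {n : nat} (a : R) (v : 'rV[R]_n) :
  quad_form a%:M v = a * quad_form 1%:M v.
Proof.
rewrite /quad_form -[a%:M]scalemx1 -scalemxAr -scalemxAl.
by move: (v *m 1%:M *m v^T) => w; rewrite mxE.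
Qed.

Lemma mx_entry_le_norm {R : realType} {m n : nat} (A : 'M[R]_(m, n)) i j :
  `|A i j| <= `|A|.
Proof.
rewrite [leRHS]mx_normrE.
exact: (le_bigmax _ (fun ij => `|A ij.1 ij.2|) (i, j)).
Qed.

(** The norm on row vectors is the max norm, attained at some entry, so its square is one term of
    the sum of squares. The reverse comparison costs a factor [n]. *)
Lemma sqr_norm_le_quad_form1 {R : realType} {n : nat} (v : 'rV[R]_n) :
  `|v| ^+ 2 <= quad_form 1%:M v.
Proof.
rewrite quad_form1; have sum_ge0 : 0 <= \sum_j v 0 j ^+ 2.
  by apply: sumr_ge0 => j _; exact: sqr_ge0.
have [->|v0] := eqVneq `|v| 0; first by rewrite expr0n.
have [[i j] /= vij] := mx_norm_neq0 v0.
rewrite [`|v|]vij (ord1 i) real_normK ?num_real// (bigD1 j)//= lerDl.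
by apply: sumr_ge0 => k _; exact: sqr_ge0.
Qed.

Lemma quad_form1_le {R : realType} {n : nat} (v : 'rV[R]_n) :
  quad_form 1%:M v <= n%:R * `|v| ^+ 2.
Proof.
rewrite quad_form1 -[n in n%:R]card_ord mulr_natl -sumr_const.
apply: ler_sum => j _; rewrite -real_normK ?num_real//.
by rewrite ler_sqr ?nnegrE ?normr_ge0// mx_entry_le_norm.
Qed.

Lemma mulmx_entry_le_norm {R : realType} {m n : nat} (v : 'rV[R]_n)
    (A : 'M[R]_(n, m)) i :
  `|(v *m A) 0 i| <= n%:R * `|v| * `|A|.
Proof.
rewrite mxE (le_trans (ler_norm_sum _ _ _))//.
rewrite -[n in n%:R]card_ord -mulrA mulr_natl -sumr_const.
by apply: ler_sum => j _; rewrite normrM ler_pM// mx_entry_le_norm.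
Qed.

(** A row of the kernel of [A] has quadratic form zero, hence vanishes. *)
Lemma symmetric_posdef_unitmx {R : realType} {n : nat} {A : 'M[R]_n} :
  symmetric_posdef A -> A \in unitmx.
Proof.
move=> [_ posA]; rewrite -row_free_unit -kermx_eq0; apply/eqP/row_matrixP => i.
rewrite row0; apply/eqP; apply: contraT => /posA; rewrite /quad_form.
by rewrite -row_mul mulmx_ker row0 mul0mx mxE ltxx.
Qed.

Lemma linear_coef_ge0 {R : realType} (c q : R) :
  (forall t, 0 < t <= 1 -> 0 <= 2 * t * c + t ^+ 2 * q) -> 0 <= c.
Proof.
move=> tP; rewrite leNgt; apply/negP => c0.
(* With [t * (|q| + 1) <= - c], the factor [2 * c + t * q] left after dividing by [t] is at most
   [c < 0]. *)
pose t := Num.min 1 (- c / (`|q| + 1)).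
have q1 : 0 < `|q| + 1 by rewrite ltr_wpDl.
have t0 : 0 < t by rewrite lt_min ltr01 divr_gt0// oppr_gt0.
have t1 : t <= 1 by rewrite ge_min lexx.
have tq : t * (`|q| + 1) <= - c by rewrite -ler_pdivlMr// ge_min lexx orbT.
have tqn : t * q <= t * `|q| by rewrite ler_pM2l// ler_norm.
have /tP : 0 < t <= 1 by rewrite t0.
have -> : 2 * t * c + t ^+ 2 * q = t * (2 * c + t * q) by ring.
by rewrite pmulr_rge0//; nra.
Qed.

(** * The dual problem and the search direction *)

Lemma gradient_dot {R : realType} {n m : nat} (F : 'rV[R]_n -> 'rV[R]_m) x i
    (v : 'rV[R]_n) :
  (v *m (gradient F i x)^T) 0 0 = (v *m 'J F x) 0 i.
Proof.
by rewrite /gradient trmxK !mxE; apply: eq_bigr => j _; rewrite mxE.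
Qed.

Lemma weighted_gradient_dot {R : realType} {n m : nat}
    (F : 'rV[R]_n -> 'rV[R]_m) x lam (v : 'rV[R]_n) :
  (v *m (weighted_gradient F x lam)^T) 0 0
  = \sum_i lam 0 i * (v *m 'J F x) 0 i.
Proof.
rewrite /weighted_gradient linear_sum/= mulmx_sumr summxE; apply: eq_bigr => i _.
by rewrite linearZ/= -scalemxAr mxE gradient_dot.
Qed.

(** [gradient F i x] is the weighted gradient at the vertex [delta_mx 0 i], and the weighted
    gradient is linear in the weights. *)
Lemma weighted_gradient_segment {R : realType} {n m : nat}
    (F : 'rV[R]_n -> 'rV[R]_m) x lam i (t : R) :
  weighted_gradient F x (lam + t *: (delta_mx 0 i - lam))
  = weighted_gradient F x lam
    + t *: (gradient F i x - weighted_gradient F x lam).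
Proof.
have -> : gradient F i x = weighted_gradient F x (delta_mx 0 i).
  rewrite /weighted_gradient (bigD1 i)//= big1 ?addr0 => [|j ji].
    by rewrite mxE !eqxx scale1r.
  by rewrite mxE (negbTE ji) andbF scale0r.
rewrite /weighted_gradient -sumrB scaler_sumr -big_split; apply: eq_bigr => j _.
by rewrite !mxE scalerDl -scalerBl scalerA.
Qed.

Lemma simplex_segment {R : realType} {m : nat} {lam : 'rV[R]_m} i {t : R} :
  simplex lam -> 0 < t <= 1 -> simplex (lam + t *: (delta_mx 0 i - lam)).
Proof.
move=> [lam1 lam0] /andP[t0 t1]; split=> [|j].
  under eq_bigr do rewrite !mxE.
  rewrite big_split/= -mulr_sumr sumrB lam1 (bigD1 i)//= big1 => [|j ji].
    by rewrite !eqxx addr0 subrr mulr0 addr0.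
  by rewrite (negbTE ji).
rewrite !mxE; have := lam0 j; set b := (_ && _)%:R.
by have b0 : 0 <= b :> R := ler0n _ _; nra.
Qed.

(* First-order optimality of the dual problem along the edges towards the
   vertices of the simplex. *)
Lemma gvmm_direction_descent {R : realType} {n m : nat}
    {F : 'rV[R]_n -> 'rV[R]_m} {x} {B : 'M[R]_n} {d} :
  symmetric_posdef B -> gvmm_direction F x B d ->
  forall i, (d *m 'J F x) 0 i <= - quad_form B d.
Proof.
move=> spdB [lam [slam lam_min ->]] i.
have uB := symmetric_posdef_unitmx spdB; have [symB _] := spdB.
have symV : (invmx B)^T = invmx B by rewrite trmx_inv symB.
have entryB (P Q : 'M[R]_1) : (P - Q) 0 0 = P 0 0 - Q 0 0 by rewrite !mxE.
have entryN (P : 'M[R]_1) : (- P) 0 0 = - P 0 0 by rewrite mxE.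
set g := weighted_gradient F x lam.
(* Along the edge the dual objective is quadratic in [t] and minimal at [t = 0]; its linear
   coefficient is therefore nonnegative. *)
have : 0 <= (g *m invmx B *m (gradient F i x - g)^T) 0 0.
  apply: (@linear_coef_ge0 _ _ (quad_form (invmx B) (gradient F i x - g))).
  move=> t /(simplex_segment i slam)/lam_min; rewrite /dual_objective.
  rewrite weighted_gradient_segment -/g quad_formD//.
  rewrite ler_pM2l ?invr_gt0//; lra.
rewrite [(_ - g)^T]linearB/= mulmxBr entryB.
have -> : quad_form B (- (g *m invmx B)) = (g *m invmx B *m g^T) 0 0.
  rewrite /quad_form mulNmx linearN/= mulNmx mulmxN opprK mulmxKV//.
  by rewrite trmx_mul symV mulmxA.
rewrite -gradient_dot mulNmx entryN; lra.
Qed.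

Lemma gvmm_direction_weights {R : realType} {n m : nat}
    {F : 'rV[R]_n -> 'rV[R]_m} {x} {B : 'M[R]_n} {d} :
  symmetric_posdef B -> gvmm_direction F x B d ->
  exists2 lam, simplex lam & weighted_gradient F x lam = - (d *m B).
Proof.
move=> /symmetric_posdef_unitmx uB [lam [slam _ ->]]; exists lam => //.
by rewrite mulNmx opprK mulmxKV.
Qed.

(** * Rejected trial steps *)

(** Uniform continuity on [K] in a form that lets [x + h] leave [K], as a rejected trial point may.
    It follows by compactness from the joint continuity of [G (x + h) - G x] at each [(x, 0)]. *)
Lemma compact_shift_continuous {R : realType} {V W : normedModType R}
    (G : V -> W) (K : set V) (e : R) :
  compact K -> continuous G -> 0 < e ->
  \forall h \near 0, K `<=` [set x | `|G (x + h) - G x| < e].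
Proof.
move=> /compact_near_coveringP cK cG e0.
apply: (cK V (nbhs 0) (fun h x => `|G (x + h) - G x| < e)) => x _.
have GD : G (z.1 + z.2) - G z.1 @[z --> (x, 0 : V)] --> G (x + 0) - G x.
  apply: cvgB; last exact: (@cvg_comp _ _ _ fst G _ (nbhs x) _ cvg_fst (cG x)).
  apply: (@cvg_comp _ _ _ (fun z => z.1 + z.2) G _ (nbhs (x + 0)) _ _ (cG _)).
  by apply: cvgD; [exact: cvg_fst|exact: cvg_snd].
by move: GD; rewrite addr0 subrr => /cvgr0_norm_lt /(_ _ e0).
Qed.

Lemma is_derive_ray {R : realType} {n m : nat} (F : 'rV[R]_n -> 'rV[R]_m)
    (y v : 'rV[R]_n) i (s : R) :
  (forall z, differentiable F z) ->
  is_derive s 1 (fun t : R => F (y + t *: v) 0 i)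
    ((v *m 'J F (y + s *: v)) 0 i).
Proof.
move=> dF; pose ray (t : R) : 'rV[R]_n := y + t *: v.
have dray : is_diff s ray (0 + *:%R^~ v) by exact: is_diffD.
have dFray : differentiable (F \o ray) s by exact: differentiable_comp.
have derFray : derivable (F \o ray) s 1 by exact: diff_derivable.
apply: DeriveDef; first by move/derivable_mxP: derFray => /(_ 0 i).
have := derive_mx derFray; rewrite (deriveE _ dFray) diff_comp//= diff_val/=.
by rewrite -(deriveE _ (dF _)) deriveEjacobian// add0r scale1r => ->; rewrite mxE.
Qed.

(** Some component [i] violates the Armijo inequality, so by the mean value theorem its slope at an
    intermediate point exceeds [sigma] times the slope at [y]. The two slopes then differ by at
    least [(1 - sigma) * c * |v| ^+ 2], while the bound [e] on the Jacobians caps the difference. *)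
Lemma not_armijo_norm_le {R : realType} {n m : nat} (F : 'rV[R]_n -> 'rV[R]_m)
    (sigma c e t : R) (y v : 'rV[R]_n) :
  (forall z, differentiable F z) -> sigma < 1 -> 0 < t ->
  (forall i, (v *m 'J F y) 0 i <= - (c * `|v| ^+ 2)) ->
  (forall s, 0 <= s <= t -> `|'J F (y + s *: v) - 'J F y| <= e) ->
  ~ armijo sigma F y v t ->
  (1 - sigma) * c * `|v| ^+ 2 <= n%:R * `|v| * e.
Proof.
move=> dF s1 t0 desc Je /existsNP[i /negP]; rewrite -ltNge => Fi.
have der s := is_derive_ray F y v i s dF.
have cont : continuous (fun s : R => F (y + s *: v) 0 i).
  move=> s; apply/differentiable_continuous/derivable1_diffP.
  by case: (der s).
have [s] := MVT t0 (fun s _ => der s) (continuous_subspaceT cont).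
rewrite in_itv/= => /andP[s0 st]; rewrite scale0r addr0 subr0 => Fst.
have vJ : sigma * (v *m 'J F y) 0 i < (v *m 'J F (y + s *: v)) 0 i.
  rewrite -(ltr_pM2r t0) -Fst; move: Fi; rewrite !mxE; lra.
have /Je {}Je : 0 <= s <= t by rewrite !ltW.
have := le_trans (ler_norm _) (mulmx_entry_le_norm v ('J F (y + s *: v) - 'J F y) i).
rewrite mulmxBr.
have -> (P Q : 'rV[R]_m) : (P - Q) 0 i = P 0 i - Q 0 i by rewrite !mxE.
move=> /le_trans /(_ (ler_wpM2l (mulr_ge0 (ler0n _ _) (normr_ge0 v)) Je)).
apply: le_trans; rewrite -mulrA.
have s1' : 0 <= 1 - sigma by rewrite subr_ge0 ltW.
have := ler_wpM2l s1' (desc i); rewrite mulrN lerNr => /le_trans; apply.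
by rewrite -mulrN mulrBl mul1r mulrN opprK addrC lerD2r ltW// -mulrN.
Qed.

(** * Estimates near a noncritical point *)

Lemma not_pareto_critical_near {R : realType} {n m : nat}
    (F : 'rV[R]_n -> 'rV[R]_m) (p : 'rV[R]_n) :
  {for p, continuous (fun y => 'J F y)} -> ~ pareto_critical F p ->
  exists (v : 'rV[R]_n) (c : R), 0 < c /\
    \forall y \near p, forall i, (v *m 'J F y) 0 i <= - c.
Proof.
move=> cJ /eqP/set0P[_ [[v _ <-] /= vneg]].
(* The default value 1 of the minimum keeps [c] positive even when [m = 0]. *)
pose c := \big[Num.min/1]_i (- (v *m 'J F p) 0 i).
have c0 : 0 < c.
  by rewrite /c; elim/big_ind : _ => // [u w u0 w0|i _]; rewrite ?lt_min ?u0// oppr_gt0.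
exists v, (c / 2); split; first exact: divr_gt0.
have N1 : 0 < n%:R * `|v| + 1 by rewrite ltr_wpDl// mulr_ge0.
(* Each entry of [v *m ('J F y - 'J F p)] then stays below [c / 2]; the added 1 avoids division by
   zero. *)
have e0 : 0 < c / 2 / (n%:R * `|v| + 1) by rewrite !divr_gt0.
move/cvgrPdist_le: cJ => /(_ _ e0).
apply: filterS => y; rewrite ler_pdivlMr// distrC => Jyp i.
have vJyp := le_trans (ler_norm _) (mulmx_entry_le_norm v ('J F y - 'J F p) i).
rewrite -[leLHS](subrK ((v *m 'J F p) 0 i)) [leRHS](_ : _ = c / 2 - c); last by field.
apply: lerD; last by rewrite lerNr; exact: bigmin_le.
have -> : (v *m 'J F y) 0 i - (v *m 'J F p) 0 i = (v *m ('J F y - 'J F p)) 0 i.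
  by rewrite mulmxBr [RHS]mxE [X in _ = _ + X]mxE.
apply: le_trans vJyp (le_trans _ Jyp).
by rewrite mulrC ler_wpM2l// lerDl.
Qed.

(** A Cauchy-Schwarz bound, obtained from nonnegativity of the form at [d - s *: v] with
    [s = c / (M + 1)]; the added 1 covers [M = 0]. *)
Lemma quad_form_ge_cross_term {R : realType} {n : nat}
    (B : 'M[R]_n) (b c : R) (d v : 'rV[R]_n) :
  B^T = B -> (forall w, 0 <= quad_form B w <= b * quad_form 1%:M w) -> 0 < c ->
  c <= (d *m B *m v^T) 0 0 ->
  c ^+ 2 / (b * quad_form 1%:M v + 1) <= b * quad_form 1%:M d.
Proof.
move=> symB Bb c0 cdBv; set M := b * quad_form 1%:M v.
have /andP[Qv0 QvM] := Bb v; have /andP[_ Qdb] := Bb d.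
have M1 : 0 < M + 1 by rewrite ltr_wpDl// (le_trans Qv0).
apply: le_trans Qdb; set s := c / (M + 1).
have s0 : 0 < s by exact: divr_gt0.
have sM : s * (M + 1) = c by rewrite divfK// gt_eqF.
have -> : c ^+ 2 / (M + 1) = s * c by rewrite /s; ring.
have /andP[+ _] := Bb (d + (- s) *: v); rewrite quad_formD//.
have sc : s * c <= s * (d *m B *m v^T) 0 0 by rewrite ler_pM2l.
have sv : s * (s * quad_form B v) <= s * (c - s).
  by rewrite ler_pM2l// -[c in c - s]sM mulrDr mulr1 addrK ler_pM2l.
have := sqr_ge0 s; lra.
Qed.

(** * Convergence of the iterates *)

Lemma has_lbound_on_compact {R : realType} {n : nat} (f : 'rV[R]_n -> R)
    (K : set 'rV[R]_n) (x : nat -> 'rV[R]_n) :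
  compact K -> continuous f -> (forall k, K (x k)) ->
  has_lbound (range (fun k => f (x k))).
Proof.
move=> cK cf xK; have K0 : K !=set0 by exists (x 0).
have [c _ cmin] := EVT_min_rV K0 cK (continuous_subspaceT cf).
by exists (f c) => _ [k _ <-]; apply: cmin; rewrite inE.
Qed.

Lemma nonincreasing_diff_cvg0 {R : realType} (u : nat -> R) :
  nonincreasing_seq u -> has_lbound (range u) -> u k - u k.+1 @[k --> \oo] --> 0.
Proof.
move=> /nonincreasing_is_cvgn /[apply] cu; rewrite -(subrr (limn u)).
by apply: cvgB => //; rewrite -(cvg_shiftS u) in cu *.
Qed.

Theorem theorem1 (R : realType) (n m : nat) (F : 'rV[R]_n -> 'rV[R]_m)
    (sigma gamma : R)
    (x : nat -> 'rV[R]_n) (B : nat -> 'M[R]_n) (d : nat -> 'rV[R]_n)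
    (hF : twice_continuously_differentiable F)
    (hsigma : 0 < sigma < 1) (hgamma : 0 < gamma < 1)
    (hgvmm : gvmm sigma gamma F x B d)
    (hx : forall k, ~ pareto_critical F (x k))
    (hB : exists a b : R, [/\ 0 < a, 0 < b &
            forall k, loewner_le a%:M (B k) /\ loewner_le (B k) b%:M])
    (hlevel : forall x0 : 'rV[R]_n, compact (level_set F x0)) :
  [/\ (fun k => x k.+1 - x k) @ \oo --> (0 : 'rV[R]_n),
      (exists p, cluster (x @ \oo) p) /\
      (forall p, cluster (x @ \oo) p -> pareto_critical F p) &
      d @ \oo --> (0 : 'rV[R]_n)].
Proof.
have [dF dJ _] := hF.
have [/andP[sigma0 sigma1] /andP[gamma0 gamma1]] := (hsigma, hgamma).
have [a [b [a0 b0 Bab]]] := hB.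
have cJ : continuous (fun y => 'J F y) by move=> y; exact: differentiable_continuous.
have cF i : continuous (fun y => F y 0 i).
  move=> y; apply: (@cvg_comp _ _ _ F (fun M => M 0 i) _ (nbhs (F y))).
    exact: (differentiable_continuous (dF y)).
  exact: coord_continuous.
have Qab k w : a * quad_form 1%:M w <= quad_form (B k) w <= b * quad_form 1%:M w.
  have [/(_ w) + /(_ w)] := Bab k.
  by rewrite !quad_formB (quad_form_scalar a) (quad_form_scalar b) !subr_ge0 => -> ->.
have desc k i : (d k *m 'J F (x k)) 0 i <= - (a * `|d k| ^+ 2).
  have [spdB dir _] := hgvmm k.
  apply: le_trans (gvmm_direction_descent spdB dir i) _; rewrite lerN2.
  have /andP[+ _] := Qab k (d k); apply: le_trans.
  by rewrite ler_pM2l// sqr_norm_le_quad_form1.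
have /choice[al alP] k : exists alpha,
    armijo_step sigma gamma F (x k) (d k) alpha /\ x k.+1 = x k + alpha *: d k.
  by have [_ _ [alpha stepk xk]] := hgvmm k; exists alpha.
have al0 k : 0 < al k by have [[j [-> _ _]] _] := alP k; exact: exprn_gt0.
have al1 k : al k <= 1.
  by have [[j [-> _ _]] _] := alP k; rewrite exprn_ile1// ltW.
have decr k i : sigma * a * (al k * `|d k| ^+ 2) <= F (x k) 0 i - F (x k.+1) 0 i.
  have [[j [alE arm _]] ->] := alP k; move: (arm i); rewrite -alE.
  rewrite [leLHS]mxE [X in _ + X]mxE => /le_trans /(_ _) armi.
  rewrite -lerN2 opprB; apply: armi.
  rewrite [leRHS](_ : _ = sigma * al k * - (a * `|d k| ^+ 2)); last by ring.
  by rewrite ler_pM2l// mulr_gt0.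
have sa0 : 0 < sigma * a by exact: mulr_gt0.
have Fdecr k i : F (x k.+1) 0 i <= F (x k) 0 i.
  rewrite -subr_ge0; apply: le_trans (decr k i).
  by rewrite mulr_ge0 ?(ltW sa0)// mulr_ge0 ?sqr_ge0// ltW.
have xL k : level_set F (x 0) (x k).
  elim: k => [i|k IHk i]; first exact: lexx.
  exact: le_trans (Fdecr k i) (IHk i).
(* For [m = 0] the simplex is empty, since an empty sum is not 1. *)
have i0 : 'I_m.
  case: (pickP 'I_m) => // noi; exfalso.
  have [_ [lam [[+ _] _ _]] _] := hgvmm 0; rewrite big_pred0//.
  by move=> /esym/eqP; rewrite oner_eq0.
have step0 : al k * `|d k| ^+ 2 @[k --> \oo] --> 0.
  have Fdiff : F (x k) 0 i0 - F (x k.+1) 0 i0 @[k --> \oo] --> 0.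
    apply: (@nonincreasing_diff_cvg0 _ (fun k => F (x k) 0 i0)).
      by apply/nonincreasing_seqP => k; exact: Fdecr.
    exact: has_lbound_on_compact (hlevel (x 0)) (cF i0) xL.
  apply: (@squeeze_cvgr _ _ _ _ (cst 0)
    (fun k => (sigma * a)^-1 * (F (x k) 0 i0 - F (x k.+1) 0 i0))).
  - near=> k; apply/andP; split; first by rewrite mulr_ge0 ?sqr_ge0// ltW.
    by rewrite ler_pdivlMl.
  - exact: cvg_cst.
  - by rewrite -[X in _ --> X](mulr0 (sigma * a)^-1); exact: cvgMr.
have step_lt e : 0 < e -> \forall k \near \oo, al k * `|d k| ^+ 2 < e ^+ 2.
  by move=> e0; move: step0 => /cvgr_lt; apply; exact: exprn_gt0.
have move_lt e : 0 < e -> \forall k \near \oo, `|al k *: d k| < e.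
  move=> e0; have := step_lt e e0; apply: filterS => k /le_lt_trans stepk.
  (* Since [al k <= 1], the squared length [al k ^+ 2 * |d k| ^+ 2] is at most
     [al k * |d k| ^+ 2]. *)
  rewrite -(@ltr_pXn2r _ 2)// ?nnegrE ?(ltW e0)//; apply: stepk.
  rewrite normrZ exprMn ler_wpM2r ?sqr_ge0// gtr0_norm//.
  by rewrite expr2 ger_pMl.
have d0 : d @ \oo --> (0 : 'rV[R]_n).
  (* [e'] is chosen so that [n%:R * e' <= (1 - sigma) * a * e], which turns the estimate for a
     rejected step into [|d k| <= e]. *)
  apply/cvgr0Pnorm_le => e e0; pose e' := (1 - sigma) * a * e / (n%:R + 1).
  have sa : 0 < (1 - sigma) * a by rewrite mulr_gt0// subr_gt0.
  have n1 : 0 < n%:R + 1 :> R by rewrite ltr_wpDl.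
  have e'0 : 0 < e' by rewrite divr_gt0// mulr_gt0.
  have /nbhs_ballP[r /= r0 rP] := compact_shift_continuous _ _ _ (hlevel (x 0)) cJ e'0.
  have := step_lt e e0; have := move_lt (gamma * r) (mulr_gt0 gamma0 r0).
  apply: filterS2 => k movek stepk.
  (* If the full step is accepted, [al k = 1] and [stepk] bounds [|d k|] directly. Otherwise the
     last rejected step is [t = al k / gamma]; the factor [gamma] in [movek] keeps [t *: d k] within
     radius [r]. *)
  have [[[|j] [alE arm back]] _] := alP k.
    move: stepk; rewrite alE expr0 mul1r ltr_pXn2r// ?nnegrE ?(ltW e0)//.
    exact: ltW.
  pose t := gamma ^+ j; have t0 : 0 < t by exact: exprn_gt0.
  have Je s : 0 <= s <= t -> `|'J F (x k + s *: d k) - 'J F (x k)| <= e'.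
    move=> /andP[s0 st]; apply/ltW/rP; last exact: xL.
    rewrite -ball_normE/= sub0r normrN normrZ ger0_norm//.
    rewrite -(ltr_pM2l gamma0); apply: le_lt_trans movek.
    rewrite normrZ gtr0_norm// alE exprS -mulrA ler_pM2l//.
    by rewrite ler_wpM2r.
  have := not_armijo_norm_le _ _ _ _ _ _ _ dF sigma1 t0 (desc k) Je (back j (leqnn _)).
  have [->|dk0] := eqVneq `|d k| 0; first by rewrite (ltW e0).
  have {}dk0 : 0 < `|d k| by rewrite lt_def dk0/=.
  rewrite expr2 mulrA -[leRHS]mulrAC ler_pM2r// => /le_trans le_e.
  rewrite -(ler_pM2l sa); apply: le_e.
  rewrite /e' mulrCA -[leRHS]mulr1 ler_pM2l ?(mulr_gt0 sa)//.
  by rewrite ler_pdivrMr// mul1r lerDl.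
split=> //.
- apply/cvgr0Pnorm_lt => e /move_lt; apply: filterS => k.
  by have [_ ->] := alP k; rewrite addrAC subrr add0r.
- split.
    have [|p [_ clp]] := hlevel (x 0) (x @ \oo) _; last by exists p.
    by apply: (@filterE _ \oo) => k; exact: xL.
  move=> p clp; apply: contrapT.
  move=> /(not_pareto_critical_near _ _ (cJ p)) [v [c [c0 vneg]]].
  (* [th] is the lower bound for [b * quad_form 1%:M (d k)] that holds whenever [x k] lies in the
     neighborhood of [p] given by [vneg]. *)
  pose th := c ^+ 2 / (b * quad_form 1%:M v + 1).
  have Q1 w : 0 <= quad_form 1%:M w :> R.
    exact: le_trans (sqr_ge0 _) (sqr_norm_le_quad_form1 w).
  have th0 : 0 < th.
    by rewrite divr_gt0 ?exprn_gt0// ltr_wpDl// mulr_ge0// ltW.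
  have Qd0 : b * (n%:R * `|d k| ^+ 2) @[k --> \oo] --> 0.
    rewrite -[X in _ --> X](mulr0 b); apply: cvgMr.
    rewrite -[X in _ --> X](mulr0 n%:R); apply: cvgMr.
    have nd0 : `|d k| @[k --> \oo] --> 0 by rewrite -(normr0 'rV[R]_n); exact: cvg_norm.
    by rewrite -[X in _ --> X](mulr0 0); exact: cvgM.
  have small := cvgr_lt _ Qd0 _ th0.
  (* The cluster property yields one index [k] with [d k] already small and [x k] in this
     neighborhood. *)
  have [_ [[k Qk <-] vk]] : (x @` [set k | b * (n%:R * `|d k| ^+ 2) < th]) `&`
      [set y | forall i, (v *m 'J F y) 0 i <= - c] !=set0.
    apply: clp vneg; case: small => N _ smallN.
    by exists N => // k /smallN Qk; exists k.
  have [spdB dir _] := hgvmm k.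
  have [lam [lam1 lam0] lamE] := gvmm_direction_weights spdB dir.
  (* As [d k *m B k] is minus a convex combination of gradients, its product with [v] averages
     numbers that are all at least [c]. *)
  have vBd : c <= (d k *m B k *m v^T) 0 0.
    have -> : (d k *m B k *m v^T) 0 0
        = - (v *m (weighted_gradient F (x k) lam)^T) 0 0.
      rewrite lamE -[in RHS](trmxK v) -trmx_mul [in RHS]mxE mulNmx.
      by rewrite [X in _ = - X]mxE opprK.
    rewrite weighted_gradient_dot lerNr -[- c]mul1r -lam1 mulr_suml.
    by apply: ler_sum => i _; rewrite ler_wpM2l.
  have QB w : 0 <= quad_form (B k) w <= b * quad_form 1%:M w.
    have /andP[Qa ->] := Qab k w; rewrite andbT; apply: le_trans Qa.
    by rewrite mulr_ge0// ltW.
  have := quad_form_ge_cross_term _ _ _ _ _ (proj1 spdB) QB c0 vBd.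
  apply/negP; rewrite -ltNge; apply: le_lt_trans Qk.
  by rewrite ler_pM2l// quad_form1_le.
Unshelve. all: by end_near.
Qed.
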